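(* Let $F \subseteq E$ be a Galois extension and let $\mathfrak{g}$ be a Lie algebra over the field $E$. Let $\mathfrak{g}_F$ be the underlying Lie algebra over $F$. Then there is an isomorphism of Lie algebras over $E$ $$\mathfrak{g}_F \otimes_F E \cong \bigoplus_{\sigma \in \mathrm{Gal}(E,F)} \mathfrak{g}^\sigma,$$ where $\mathfrak{g}^\sigma$ denotes the $\sigma$-conjugate of $\mathfrak{g}$.
   Context: A Galois extension $F \subseteq E$ means a field extension of finite degree with $|\mathrm{Aut}(E,F)| = [E:F]$, where $\mathrm{Aut}(E,F)$ is the group of field automorphisms of $E$ fixing $F$ pointwise; then $\mathrm{Gal}(E,F) = \mathrm{Aut}(E,F)$. The underlying Lie algebra $\mathfrak{g}_F$ is $\mathfrak{g}$ regarded as a Lie algebra over $F$ by restricting the scalar multiplication. For a field automorphism $\sigma$ of $E$, a map $\varphi: V \to W$ between $E$-vector spaces is $\sigma$-linear if $\varphi(\lambda v + \mu w) = \sigma(\lambda)\varphi(v) + \sigma(\mu)\varphi(w)$ for all $v,w \in V$, $\lambda,\mu \in E$; a $\sigma$-isomorphism of Lie algebras over $E$ is a bijective $\sigma$-linear map preserving the Lie bracket. The $\sigma$-conjugate $\mathfrak{g}^\sigma$ of $\mathfrak{g}$ is the Lie algebra over $E$, unique up to isomorphism, for which there exists a $\sigma$-isomorphism $\varphi^\sigma: \mathfrak{g} \to \mathfrak{g}^\sigma$ (equivalently, its structure constants with respect to some basis are obtained by applying $\sigma$ to the structure constants of $\mathfrak{g}$ with respect to a basis). *)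

(* Defs.v *)
From HB Require Import structures.
From mathcomp Require Import all_boot all_order all_fingroup all_algebra all_field.
From mathcomp Require Import generic_quotient ring_quotient boolp freeg.

Set Implicit Arguments.
Unset Strict Implicit.
Unset Printing Implicit Defensive.

Import GRing.Theory.
Local Open Scope ring_scope.
Local Open Scope quotient_scope.

(* [galois 1 {:E}] says that the automorphism group of E over F has order
   [E : F].  Taking E in splittingFieldType loses nothing: a finite extension
   with that many automorphisms is a splitting field over F. *)
Lemma galois_card (F : fieldType) (E : splittingFieldType F) :
  galois 1 {:E} = (#|'Gal({:E} / 1)%g| == \dim {:E}).
Proof.
apply/idP/eqP => [/galois_dim <-|card_gal]; first by rewrite dimv1 divn1.
have fixF : (1 <= fixedField 'Gal({:E} / 1)%g)%VS by exact: sub1v.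
apply/galois_fixedField/eqP; rewrite eq_sym eqEdim fixF dimv1 /=.
have := dim_fixedField [group of 'Gal({:E} / 1)%g].
rewrite card_gal => /esym/eqP dimE.
have /divnK := field_dimS (fixedField_bound 'Gal({:E} / 1)%g).
rewrite (eqP dimE) -[X in _ = X]muln1 => /eqP.
by rewrite eqn_pmul2l ?adim_gt0 // => /eqP ->.
Qed.

(* Lie algebras of arbitrary (possibly infinite) dimension. *)

HB.mixin Record isLieAlgebra (K : fieldType) V of GRing.Lmodule K V := {
  lie : V -> V -> V;
  lie_linearl : forall y, linear (fun x => lie x y);
  lie_linearr : forall x, linear (lie x);
  liexx : forall x, lie x x = 0;
  lie_jacobi : forall x y z,
    lie x (lie y z) + lie y (lie z x) + lie z (lie x y) = 0
}.

#[short(type="lieAlgType")]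
HB.structure Definition LieAlgebra (K : fieldType) :=
  {V of GRing.Lmodule K V & isLieAlgebra K V}.

Section LieTheory.
Variables (K : fieldType) (g : lieAlgType K).
Implicit Types x y z : g.

Lemma lieDl x y z : lie (x + y) z = lie x z + lie y z.
Proof. by have := lie_linearl z 1 x y; rewrite !scale1r. Qed.

Lemma lieDr x y z : lie x (y + z) = lie x y + lie x z.
Proof. by have := lie_linearr x 1 y z; rewrite !scale1r. Qed.

Lemma lie0r x : lie x 0 = 0.
Proof. by apply: (addIr (lie x 0)); rewrite -lieDr !add0r. Qed.

Lemma lie0l x : lie 0 x = 0.
Proof. by apply: (addIr (lie 0 x)); rewrite -lieDl !add0r. Qed.

Lemma lieZl a x y : lie (a *: x) y = a *: lie x y.
Proof. by have := lie_linearl y a x 0; rewrite lie0l !addr0. Qed.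

Lemma lieZr a x y : lie x (a *: y) = a *: lie x y.
Proof. by have := lie_linearr x a y 0; rewrite lie0r !addr0. Qed.

Lemma lieC x y : lie x y = - lie y x.
Proof.
have := liexx (x + y); rewrite lieDl !lieDr !liexx add0r addr0.
by move/eqP; rewrite addr_eq0 => /eqP.
Qed.

End LieTheory.

Definition lie_isomorphic (K : fieldType) (g h : lieAlgType K) : Prop :=
  exists f : {linear g -> h}, bijective f /\ {morph f : x y / lie x y}.

Definition semilinear_map (E : fieldType) (s : E -> E) (V W : lmodType E)
    (f : V -> W) : Prop :=
  forall (a b : E) (v w : V), f (a *: v + b *: w) = s a *: f v + s b *: f w.

Definition semilinear_lie_iso (E : fieldType) (s : E -> E) (g h : lieAlgType E)
    (f : g -> h) : Prop :=
  [/\ bijective f, semilinear_map s f & {morph f : x y / lie x y}].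

(* [h] is (a model of) the [s]-conjugate of [g]; such an [h] is unique up to
   isomorphism. *)
Definition is_conjugate (E : fieldType) (s : E -> E) (g h : lieAlgType E) :
    Prop :=
  exists f : g -> h, semilinear_lie_iso s f.

(* Conjugates exist: keep the bracket of g and let a act as s^-1 a. *)

Definition conj_lie (F : fieldType) (E : splittingFieldType F)
  (s : gal_of {:E}) (g : lieAlgType E) : Type := g.

Section ConjLie.
Variables (F : fieldType) (E : splittingFieldType F) (s : gal_of {:E}).
Variable g : lieAlgType E.
Local Notation gs := (conj_lie s g).

HB.instance Definition _ := GRing.Zmodule.on gs.

Definition conj_scale (a : E) (x : gs) : gs := (s^-1)%g a *: (x : g).

Fact conj_scaleA a b x : conj_scale a (conj_scale b x) = conj_scale (a * b) x.
Proof. by rewrite /conj_scale scalerA rmorphM. Qed.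

Fact conj_scale1 : left_id 1 conj_scale.
Proof. by move=> x; rewrite /conj_scale rmorph1 scale1r. Qed.

Fact conj_scaleDr : right_distributive conj_scale +%R.
Proof. by move=> a x y; rewrite /conj_scale scalerDr. Qed.

Fact conj_scaleDl x : {morph conj_scale^~ x : a b / a + b}.
Proof. by move=> a b; rewrite /conj_scale rmorphD scalerDl. Qed.

HB.instance Definition _ := GRing.Zmodule_isLmodule.Build E gs
  conj_scaleA conj_scale1 conj_scaleDr conj_scaleDl.

Definition conj_bracket (x y : gs) : gs := lie (x : g) (y : g).

Fact conj_linearl (y : gs) : linear (fun x : gs => conj_bracket x y).
Proof. by move=> a u v; exact: (lie_linearl (y : g) ((s^-1)%g a)). Qed.

Fact conj_linearr (x : gs) : linear (conj_bracket x).
Proof. by move=> a u v; exact: (lie_linearr (x : g) ((s^-1)%g a)). Qed.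

Fact conj_liexx (x : gs) : conj_bracket x x = 0.
Proof. exact: (@liexx E g). Qed.

Fact conj_jacobi (x y z : gs) :
  conj_bracket x (conj_bracket y z) + conj_bracket y (conj_bracket z x)
  + conj_bracket z (conj_bracket x y) = 0.
Proof. exact: (@lie_jacobi E g). Qed.

HB.instance Definition _ := isLieAlgebra.Build E gs
  conj_linearl conj_linearr conj_liexx conj_jacobi.

Lemma conj_lieP : is_conjugate s g gs.
Proof.
exists (fun x : g => x : gs); split=> //; first by exists (fun x : gs => x : g).
move=> a b v w.
have sK c : (s^-1)%g (s c) = c by rewrite -galM ?memvf // mulgV gal_id.
by congr (_ + _); rewrite [RHS]/(_ *: (_ : g)) [in RHS]sK.
Qed.

End ConjLie.

(* The underlying Lie algebra over F of a Lie algebra over E. *)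

Definition restrict_lie (F : fieldType) (E : fieldExtType F) (g : lieAlgType E)
  : Type := g.

Section RestrictLie.
Variables (F : fieldType) (E : fieldExtType F) (g : lieAlgType E).
Local Notation gF := (restrict_lie g).

HB.instance Definition _ := GRing.Zmodule.on gF.

Definition restrict_scale (a : F) (x : gF) : gF := (a%:A : E) *: (x : g).

Fact restrict_scaleA a b x :
  restrict_scale a (restrict_scale b x) = restrict_scale (a * b) x.
Proof. by rewrite /restrict_scale scalerA mulr_algl scalerA. Qed.

Fact restrict_scale1 : left_id 1 restrict_scale.
Proof. by move=> x; rewrite /restrict_scale !scale1r. Qed.

Fact restrict_scaleDr : right_distributive restrict_scale +%R.
Proof. by move=> a x y; rewrite /restrict_scale scalerDr. Qed.

Fact restrict_scaleDl x : {morph restrict_scale^~ x : a b / a + b}.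
Proof. by move=> a b; rewrite /restrict_scale scalerDl scalerDl. Qed.

HB.instance Definition _ := GRing.Zmodule_isLmodule.Build F gF
  restrict_scaleA restrict_scale1 restrict_scaleDr restrict_scaleDl.

Definition restrict_bracket (x y : gF) : gF := lie (x : g) (y : g).

Fact restrict_linearl (y : gF) : linear (fun x : gF => restrict_bracket x y).
Proof. by move=> a u v; exact: (lie_linearl (y : g) (a%:A : E)). Qed.

Fact restrict_linearr (x : gF) : linear (restrict_bracket x).
Proof. by move=> a u v; exact: (lie_linearr (x : g) (a%:A : E)). Qed.

Fact restrict_liexx (x : gF) : restrict_bracket x x = 0.
Proof. exact: (@liexx E g). Qed.

Fact restrict_jacobi (x y z : gF) :
  restrict_bracket x (restrict_bracket y z)
  + restrict_bracket y (restrict_bracket z x)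
  + restrict_bracket z (restrict_bracket x y) = 0.
Proof. exact: (@lie_jacobi E g). Qed.

HB.instance Definition _ := isLieAlgebra.Build F gF
  restrict_linearl restrict_linearr restrict_liexx restrict_jacobi.

End RestrictLie.

(* The tensor product over K of two K-vector spaces: the free abelian group on
   U * V modulo the subgroup generated by the K-bilinearity relations. *)

Section Tensor.
Variables (K : fieldType) (U V : lmodType K).

Local Notation free := {freeg (U * V) / int}.
Local Notation "<| u , v |>" := (<< (u, v) >> : free).

Inductive tensor_rel : free -> Prop :=
| TensorRel0 : tensor_rel 0
| TensorRelB s t : tensor_rel s -> tensor_rel t -> tensor_rel (s - t)
| TensorRelDl u u' v : tensor_rel (<|u + u', v|> - (<|u, v|> + <|u', v|>))
| TensorRelDr u v v' : tensor_rel (<|u, v + v'|> - (<|u, v|> + <|u, v'|>))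
| TensorRelZ (a : K) u v : tensor_rel (<|a *: u, v|> - <|u, a *: v|>).

Definition tensor_relb : {pred free} := fun s => `[< tensor_rel s >].

Fact tensor_relb_closed : zmod_closed tensor_relb.
Proof.
split=> [|s t]; first by apply/asboolP; exact: TensorRel0.
by move=> /asboolP rs /asboolP rt; apply/asboolP; exact: TensorRelB.
Qed.

HB.instance Definition _ :=
  GRing.isZmodClosed.Build free tensor_relb tensor_relb_closed.

Definition tensor : Type := Quotient.quot tensor_relb.
HB.instance Definition _ := GRing.Zmodule.on tensor.

Definition tens (u : U) (v : V) : tensor :=
  \pi_(Quotient.quot tensor_relb) <|u, v|>.

Lemma tensP s : tensor_rel s -> \pi_(Quotient.quot tensor_relb) s = 0.
Proof.
move=> rs; rewrite -[0 in RHS]pi_zeror; apply/eqP.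
by rewrite -Quotient.idealrBE subr0; apply/asboolP.
Qed.

Lemma tensDl u u' v : tens (u + u') v = tens u v + tens u' v.
Proof.
apply/eqP; rewrite -subr_eq0 /tens -!raddfD -raddfB /=; apply/eqP/tensP.
exact: TensorRelDl.
Qed.

Lemma tensDr u v v' : tens u (v + v') = tens u v + tens u v'.
Proof.
apply/eqP; rewrite -subr_eq0 /tens -!raddfD -raddfB /=; apply/eqP/tensP.
exact: TensorRelDr.
Qed.

Lemma tensZ a u v : tens (a *: u) v = tens u (a *: v).
Proof.
apply/eqP; rewrite -subr_eq0 /tens -raddfB /=; apply/eqP/tensP.
exact: TensorRelZ.
Qed.

Lemma tensor_ind (P : tensor -> Prop) :
  P 0 -> (forall s t, P s -> P t -> P (s - t)) -> (forall u v, P (tens u v)) ->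
  forall t, P t.
Proof.
move=> P0 PB Pt.
have PN s : P s -> P (- s) by move=> Ps; rewrite -[- s]add0r; exact: PB.
have PD s t : P s -> P t -> P (s + t).
  by move=> Ps Pt'; rewrite -[t]opprK; apply: PB => //; exact: PN.
have PM s n : P s -> P (s *+ n).
  by move=> Ps; elim: n => [|n IHn]; rewrite ?mulr0n// mulrS; exact: PD.
move=> t; rewrite -[t]reprK -[repr t]freeg_sumE raddf_sum /=.
elim/big_ind: _ => // -[u v] _.
move: (coeff _ _) => n; have Puv := Pt u v.
have -> : << n *g (u, v) >> = <|u, v|> *~ n by rewrite freegU_mulz intz.
rewrite raddfMz /=.
by case: n => n; [exact: PM | apply: PN; exact: PM].
Qed.

Section Lift.
Variables (W : zmodType) (f : U -> V -> W).

(* The additive map sending [tens u v] to [f u v]; it is meaningful only when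
   [f] is balanced. *)
Definition tensor_lift (t : tensor) : W :=
  fglift (fun p : U * V => f p.1 p.2 : zmodule W)
    (repr (t : Quotient.quot tensor_relb)).

Record balanced : Prop := Balanced {
  balancedDl : forall u u' v, f (u + u') v = f u v + f u' v;
  balancedDr : forall u v v', f u (v + v') = f u v + f u v';
  balancedZ : forall (a : K) u v, f (a *: u) v = f u (a *: v)
}.

Hypothesis bal_f : balanced.

Local Notation flift := (fglift (fun p : U * V => f p.1 p.2 : zmodule W)).

Let fliftB s t : flift (s - t) = flift s - flift t.
Proof. exact: (lift_is_additive (fun p : U * V => f p.1 p.2 : zmodule W)). Qed.

Let flift0 : flift 0 = 0.
Proof. by rewrite -[0](subrr 0) fliftB subrr. Qed.

Let fliftD s t : flift (s + t) = flift s + flift t.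
Proof. by rewrite -[t in LHS]opprK -[- t]add0r !fliftB flift0 sub0r opprK. Qed.

Let fliftU u v : flift <|u, v|> = f u v.
Proof. by rewrite liftU scale1r. Qed.

Let flift_rel s : tensor_rel s -> flift s = 0.
Proof.
elim=> {s} [|s t _ IHs _ IHt|u u' v|u v v'|a u v].
- exact: flift0.
- by rewrite fliftB IHs IHt subrr.
- by rewrite fliftB fliftD !fliftU balancedDl ?subrr.
- by rewrite fliftB fliftD !fliftU balancedDr ?subrr.
- by rewrite fliftB !fliftU balancedZ ?subrr.
Qed.

Let tensor_lift_pi s :
  tensor_lift (\pi_(Quotient.quot tensor_relb) s) = flift s.
Proof.
apply/eqP; rewrite -subr_eq0 -fliftB; apply/eqP/flift_rel/asboolP.
by have := Quotient.idealrBE tensor_relb (repr (\pi_(Quotient.quot tensor_relb) s)) s;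
  rewrite reprK eqxx.
Qed.

Lemma tensor_lift_tens u v : tensor_lift (tens u v) = f u v.
Proof. by rewrite tensor_lift_pi fliftU. Qed.

Lemma tensor_liftB s t : tensor_lift (s - t) = tensor_lift s - tensor_lift t.
Proof.
by rewrite -[s]reprK -[t]reprK -raddfB !tensor_lift_pi fliftB.
Qed.

Lemma tensor_lift0 : tensor_lift 0 = 0.
Proof. by rewrite -[0](subrr 0) tensor_liftB subrr. Qed.

Lemma tensor_liftD s t : tensor_lift (s + t) = tensor_lift s + tensor_lift t.
Proof.
by rewrite -[t in LHS]opprK -[- t]add0r !tensor_liftB tensor_lift0 sub0r opprK.
Qed.

End Lift.

End Tensor.

Arguments tens {K U V} u v.

(* Extension of scalars: the Lie algebra h ⊗_F E over E, with
   a *: (x ⊗ b) = x ⊗ (a * b) and lie (x ⊗ a) (y ⊗ b) = lie x y ⊗ (a * b). *)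

Definition base_change (F : fieldType) (E : fieldExtType F) (h : lieAlgType F)
  : Type := tensor h E.

Section BaseChange.
Variables (F : fieldType) (E : fieldExtType F) (h : lieAlgType F).
Local Notation hE := (base_change E h).
Local Notation "x ⊗ a" := (tens (x : h) (a : E) : hE) (at level 40).

HB.instance Definition _ := GRing.Zmodule.on hE.

Definition base_scale (a : E) (t : hE) : hE :=
  tensor_lift (fun x b => x ⊗ (a * b)) t.

Definition base_lie (s t : hE) : hE :=
  tensor_lift (fun x a => tensor_lift (fun y b => lie x y ⊗ (a * b)) t) s.

Fact base_scale_balanced a : balanced (fun x b => x ⊗ (a * b)).
Proof.
split=> [x x' b|x b b'|c x b].
- exact: tensDl.
- by rewrite mulrDr; exact: tensDr.
- by rewrite -scalerAr; exact: tensZ.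
Qed.

Fact base_scale_tens a x b : base_scale a (x ⊗ b) = x ⊗ (a * b).
Proof. exact/tensor_lift_tens/base_scale_balanced. Qed.

Fact base_scaleB a : {morph base_scale a : s t / s - t}.
Proof. exact/tensor_liftB/base_scale_balanced. Qed.

Fact base_scaleDr : right_distributive base_scale +%R.
Proof. by move=> a; exact/tensor_liftD/base_scale_balanced. Qed.

Fact base_scale0 a : base_scale a 0 = 0.
Proof. exact/tensor_lift0/base_scale_balanced. Qed.

Fact base_scaleA a b t : base_scale a (base_scale b t) = base_scale (a * b) t.
Proof.
elim/tensor_ind: t => [|s t IHs IHt|x c].
- by rewrite !base_scale0.
- by rewrite !base_scaleB IHs IHt.
- by rewrite !base_scale_tens mulrA.
Qed.

Fact base_scale1 : left_id 1 base_scale.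
Proof.
elim/tensor_ind => [|s t IHs IHt|x c].
- by rewrite base_scale0.
- by rewrite base_scaleB IHs IHt.
- by rewrite base_scale_tens mul1r.
Qed.

Fact base_scaleDl t : {morph base_scale^~ t : a b / a + b}.
Proof.
move=> a b; elim/tensor_ind: t => [|s t IHs IHt|x c].
- by rewrite !base_scale0 addr0.
- by rewrite !base_scaleB IHs IHt opprD addrACA.
- by rewrite !base_scale_tens mulrDl; exact: tensDr.
Qed.

HB.instance Definition _ := GRing.Zmodule_isLmodule.Build E hE
  base_scaleA base_scale1 base_scaleDr base_scaleDl.

Fact base_lie_balancedr x a : balanced (fun y b => lie x y ⊗ (a * b)).
Proof.
split=> [y y' b|y b b'|c y b].
- by rewrite lieDr; exact: tensDl.
- by rewrite mulrDr; exact: tensDr.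
- by rewrite lieZr -scalerAr; exact: tensZ.
Qed.

Fact base_lie_balancedl t :
  balanced (fun x a => tensor_lift (fun y b => lie x y ⊗ (a * b)) t).
Proof.
have bal := base_lie_balancedr; split=> [x x' a|x a a'|c x a].
- elim/tensor_ind: t => [|s t IHs IHt|y b].
  + by rewrite !tensor_lift0 ?addr0.
  + by rewrite !tensor_liftB// IHs IHt opprD addrACA.
  + by rewrite !tensor_lift_tens// lieDl; exact: tensDl.
- elim/tensor_ind: t => [|s t IHs IHt|y b].
  + by rewrite !tensor_lift0 ?addr0.
  + by rewrite !tensor_liftB// IHs IHt opprD addrACA.
  + by rewrite !tensor_lift_tens// mulrDl; exact: tensDr.
- elim/tensor_ind: t => [|s t IHs IHt|y b].
  + by rewrite !tensor_lift0.
  + by rewrite !tensor_liftB// IHs IHt.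
  + by rewrite !tensor_lift_tens// lieZl -scalerAl; exact: tensZ.
Qed.

Lemma base_lie_tens x a y b :
  base_lie (x ⊗ a) (y ⊗ b) = lie x y ⊗ (a * b).
Proof.
rewrite /base_lie tensor_lift_tens; last exact: base_lie_balancedl.
exact/tensor_lift_tens/base_lie_balancedr.
Qed.

Fact base_lieBl r s t : base_lie (s - t) r = base_lie s r - base_lie t r.
Proof. exact/tensor_liftB/base_lie_balancedl. Qed.

Fact base_lie0l t : base_lie 0 t = 0.
Proof. exact/tensor_lift0/base_lie_balancedl. Qed.

Fact base_lieDl r s t : base_lie (s + t) r = base_lie s r + base_lie t r.
Proof. exact/tensor_liftD/base_lie_balancedl. Qed.

Fact base_lie0r s : base_lie s 0 = 0.
Proof.
elim/tensor_ind: s => [|s t IHs IHt|x a]; first exact: base_lie0l.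
  by rewrite base_lieBl IHs IHt subrr.
rewrite /base_lie tensor_lift_tens; last exact: base_lie_balancedl.
exact/tensor_lift0/base_lie_balancedr.
Qed.

Fact base_lieBr r s t : base_lie r (s - t) = base_lie r s - base_lie r t.
Proof.
elim/tensor_ind: r => [|r r' IHr IHr'|x a].
- by rewrite !base_lie0l subrr.
- by rewrite !base_lieBl IHr IHr' !opprD !opprK addrACA.
rewrite /base_lie !tensor_lift_tens; try exact: base_lie_balancedl.
exact/tensor_liftB/base_lie_balancedr.
Qed.

Fact base_lieDr r s t : base_lie r (s + t) = base_lie r s + base_lie r t.
Proof.
by rewrite -[t in LHS]opprK -[- t]add0r !base_lieBr base_lie0r sub0r opprK.
Qed.

Fact base_lieZl a s t : base_lie (a *: s) t = a *: base_lie s t.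
Proof.
elim/tensor_ind: s => [|s s' IHs IHs'|x b].
- by rewrite scaler0 base_lie0l scaler0.
- by rewrite scalerBr !base_lieBl IHs IHs' scalerBr.
elim/tensor_ind: t => [|t t' IHt IHt'|y c].
- by rewrite !base_lie0r scaler0.
- by rewrite !base_lieBr IHt IHt' scalerBr.
by rewrite [a *: _]base_scale_tens !base_lie_tens [RHS]base_scale_tens mulrA.
Qed.

Fact base_lieZr a s t : base_lie s (a *: t) = a *: base_lie s t.
Proof.
elim/tensor_ind: s => [|s s' IHs IHs'|x b].
- by rewrite !base_lie0l scaler0.
- by rewrite !base_lieBl IHs IHs' scalerBr.
elim/tensor_ind: t => [|t t' IHt IHt'|y c].
- by rewrite scaler0 base_lie0r scaler0.
- by rewrite scalerBr !base_lieBr IHt IHt' scalerBr.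
by rewrite [a *: _]base_scale_tens !base_lie_tens [RHS]base_scale_tens mulrCA.
Qed.

Fact base_lieC s t : base_lie s t = - base_lie t s.
Proof.
elim/tensor_ind: s => [|s s' IHs IHs'|x a].
- by rewrite base_lie0l base_lie0r oppr0.
- by rewrite base_lieBl base_lieBr IHs IHs' opprD.
elim/tensor_ind: t => [|t t' IHt IHt'|y b].
- by rewrite base_lie0l base_lie0r oppr0.
- by rewrite base_lieBl base_lieBr IHt IHt' opprD.
rewrite !base_lie_tens lieC mulrC; apply/eqP; rewrite -addr_eq0 -tensDl addNr.
by apply/eqP/(addIr (tens 0 (b * a))); rewrite -tensDl !add0r.
Qed.

Fact base_linearl t : linear (fun s => base_lie s t).
Proof. by move=> a s s'; rewrite base_lieDl base_lieZl. Qed.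

Fact base_linearr s : linear (base_lie s).
Proof. by move=> a t t'; rewrite base_lieDr base_lieZr. Qed.

Fact base_liexx t : base_lie t t = 0.
Proof.
elim/tensor_ind: t => [|s t IHs IHt|x a]; first exact: base_lie0l.
  rewrite base_lieBl !base_lieBr IHs IHt [base_lie t s]base_lieC.
  by rewrite sub0r subr0 opprK addNr.
rewrite base_lie_tens liexx.
by apply: (addIr (tens 0 (a * a))); rewrite -tensDl !add0r.
Qed.

Fact base_jacobi r s t :
  base_lie r (base_lie s t) + base_lie s (base_lie t r)
  + base_lie t (base_lie r s) = 0.
Proof.
have sumB (u v w u' v' w' : hE) :
    u - u' + (v - v') + (w - w') = u + v + w - (u' + v' + w').
  by rewrite !opprD [X in X + (w - w')]addrACA [LHS]addrACA.
elim/tensor_ind: r => [|r r' IHr IHr'|x a].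
- by rewrite !(base_lie0l, base_lie0r) !addr0.
- by rewrite !(base_lieBl, base_lieBr) sumB IHr IHr' subrr.
elim/tensor_ind: s => [|s s' IHs IHs'|y b].
- by rewrite !(base_lie0l, base_lie0r) !addr0.
- by rewrite !(base_lieBl, base_lieBr) sumB IHs IHs' subrr.
elim/tensor_ind: t => [|t t' IHt IHt'|z c].
- by rewrite !(base_lie0l, base_lie0r) !addr0.
- by rewrite !(base_lieBl, base_lieBr) sumB IHt IHt' subrr.
have -> : base_lie (x ⊗ a) (base_lie (y ⊗ b) (z ⊗ c))
    = lie x (lie y z) ⊗ (a * b * c) by rewrite !base_lie_tens mulrA.
have -> : base_lie (y ⊗ b) (base_lie (z ⊗ c) (x ⊗ a))
    = lie y (lie z x) ⊗ (a * b * c).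
  by rewrite !base_lie_tens mulrA mulrC mulrA.
have -> : base_lie (z ⊗ c) (base_lie (x ⊗ a) (y ⊗ b))
    = lie z (lie x y) ⊗ (a * b * c) by rewrite !base_lie_tens mulrC.
rewrite -!tensDl lie_jacobi.
by apply: (addIr (tens 0 (a * b * c))); rewrite -tensDl !add0r.
Qed.

HB.instance Definition _ := isLieAlgebra.Build E hE
  base_linearl base_linearr base_liexx base_jacobi.

End BaseChange.

(* The direct sum of a finite family of Lie algebras. *)

Definition lie_dsum (K : fieldType) (I : finType) (V : I -> lieAlgType K)
  : Type := {dffun forall i : I, V i}.

Section DirectSum.
Variables (K : fieldType) (I : finType) (V : I -> lieAlgType K).
Local Notation W := (lie_dsum V).
Implicit Types f g h : W.

HB.instance Definition _ := Choice.on W.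

Definition dsum_zero : W := [ffun i => 0 : V i].
Definition dsum_opp f : W := [ffun i => - (f i) : V i].
Definition dsum_add f g : W := [ffun i => f i + g i : V i].
Definition dsum_scale (a : K) f : W := [ffun i => a *: f i : V i].
Definition dsum_lie f g : W := [ffun i => lie (f i) (g i) : V i].

Fact dsum_addA : associative dsum_add.
Proof. by move=> f g h; apply/ffunP => i; rewrite !ffunE addrA. Qed.

Fact dsum_addC : commutative dsum_add.
Proof. by move=> f g; apply/ffunP => i; rewrite !ffunE addrC. Qed.

Fact dsum_add0 : left_id dsum_zero dsum_add.
Proof. by move=> f; apply/ffunP => i; rewrite !ffunE add0r. Qed.

Fact dsum_addN : left_inverse dsum_zero dsum_opp dsum_add.
Proof. by move=> f; apply/ffunP => i; rewrite !ffunE addNr. Qed.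

HB.instance Definition _ := GRing.isZmodule.Build W
  dsum_addA dsum_addC dsum_add0 dsum_addN.

Fact dsum_scaleA a b f :
  dsum_scale a (dsum_scale b f) = dsum_scale (a * b) f.
Proof. by apply/ffunP => i; rewrite !ffunE scalerA. Qed.

Fact dsum_scale1 : left_id 1 dsum_scale.
Proof. by move=> f; apply/ffunP => i; rewrite !ffunE scale1r. Qed.

Fact dsum_scaleDr : right_distributive dsum_scale +%R.
Proof. by move=> a f g; apply/ffunP => i; rewrite !ffunE scalerDr. Qed.

Fact dsum_scaleDl f : {morph dsum_scale^~ f : a b / a + b}.
Proof. by move=> a b; apply/ffunP => i; rewrite !ffunE scalerDl. Qed.

HB.instance Definition _ := GRing.Zmodule_isLmodule.Build K W
  dsum_scaleA dsum_scale1 dsum_scaleDr dsum_scaleDl.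

Fact dsum_linearl g : linear (fun f => dsum_lie f g).
Proof. by move=> a f f'; apply/ffunP => i; rewrite !ffunE lieDl lieZl. Qed.

Fact dsum_linearr f : linear (dsum_lie f).
Proof. by move=> a g g'; apply/ffunP => i; rewrite !ffunE lieDr lieZr. Qed.

Fact dsum_liexx f : dsum_lie f f = 0.
Proof. by apply/ffunP => i; rewrite !ffunE liexx. Qed.

Fact dsum_jacobi f g h :
  dsum_lie f (dsum_lie g h) + dsum_lie g (dsum_lie h f)
  + dsum_lie h (dsum_lie f g) = 0.
Proof. by apply/ffunP => i; rewrite !ffunE lie_jacobi. Qed.

HB.instance Definition _ := isLieAlgebra.Build K W
  dsum_linearl dsum_linearr dsum_liexx dsum_jacobi.

End DirectSum.

(* Main.v *)
(* The isomorphism sends x ⊗ a to the family (a f_s(x))_s, where f_s : g -> g^s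
   is the given s-isomorphism.  By Dedekind's independence of automorphisms,
   the matrix (s(b_i)) attached to an F-basis b of E is invertible, which gives
   elements e_(s,i) of E with sum_i b_i t(e_(s,i)) = [s = t] and
   sum_s e_(s,i) s^-1(b_j) = [i = j].  The inverse map then sends (f_s(y_s))_s
   to sum_(s,i) e_(s,i) y_s ⊗ b_i: no basis of g is needed, so the dimension of
   g plays no role. *)
Require Import Defs.
From HB Require Import structures.
From mathcomp Require Import all_boot all_order all_fingroup all_algebra all_field.
From mathcomp Require Import boolp.

Set Implicit Arguments.
Unset Strict Implicit.
Unset Printing Implicit Defensive.

Import GRing.Theory.
Local Open Scope ring_scope.

Section DualBasis.
Variables (F : fieldType) (E : splittingFieldType F).
Local Notation G := [subg 'Gal({:E} / 1)].
Local Notation gal s := (sgval s : gal_of {:E}).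

Lemma gal_invK (s : gal_of {:E}) : cancel (s^-1)%g s.
Proof. by move=> a; rewrite -galM ?memvf // mulVg gal_id. Qed.

Lemma gal_base (s : gal_of {:E}) (c : F) : s c%:A = c%:A.
Proof. by rewrite linearZ /= rmorph1. Qed.

(** The last two clauses are the two inverse identities between [e] and the matrix of conjugates of
    [b]. The second clause also makes [b] linearly independent over F, hence a basis. *)
Lemma galois_dual_basis : galois 1 {:E} ->
  exists n (b : 'I_n -> E) (e : G -> 'I_n -> E),
  [/\ forall a, exists c : 'I_n -> F, a = \sum_i c i *: b i,
      forall i j, \sum_s e s i * ((gal s)^-1)%g (b j) = (i == j)%:R
    & forall s t, \sum_i b i * gal t (e s i) = (s == t)%:R].
Proof.
move=> /galois_fixedField fixE.
(* Dedekind's theorem in matrix form: the matrix (s(w_j)) is invertible, and [w] spans E over the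
   fixed field, which is F by [fixE]. *)
have [w _ [uM _ /(_ (groupP _))]] := gal_matrix 'Gal({:E} / 1)%g.
rewrite {}fixE => spanE.
set n := #|_| in w uM spanE; set M := \matrix_(i, j) _ in uM.
(* The default of [enum_rank_in] never occurs, as [sgval s] lies in the Galois group. *)
pose rk (s : G) : 'I_n := enum_rank_in (group1 _) (sgval s).
have rkK s : enum_val (rk s) = sgval s by rewrite enum_rankK_in ?subgP.
have rk_inj : injective rk.
  by move=> s t eq_st; apply: val_inj; rewrite /= -!rkK eq_st.
pose N := invmx M.
(* Row [rk s^-1] of [M] is (s^-1(w_j))_j, so with [e] read at s^-1 the second clause is N M = 1
   reindexed by automorphisms. *)
exists n, (tnth w), (fun s i => N i (rk s^-1%g)); split=> [a|i j|s t].
- have : a \in (\sum_i 1 * <[tnth w i]>)%VS by rewrite spanE memvf.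
  case/memv_sumP=> v v_w ->.
  have /choice[c cE] i : exists k : F, v i = k *: tnth w i.
    by apply/vlineP; have := v_w i isT; rewrite prod1v.
  by exists c; apply: eq_bigr.
- have := congr1 (fun A : 'M_n => A i j) (mulVmx uM); rewrite !mxE => <-.
  rewrite (reindex_inj invg_inj) (reindex (fun k : 'I_n => subg _ (enum_val k))).
    apply: eq_bigr => k _; rewrite invgK mxE; congr (_ * _).
      congr (N i _); apply: enum_val_inj.
      by rewrite rkK subgK ?enum_valP.
    by rewrite -[sgval _]/(val _) /= invgK subgK ?enum_valP.
  exists rk => [k _|s _]; last by rewrite rkK sgvalK.
  by apply: enum_val_inj; rewrite rkK subgK ?enum_valP.
(* This entry of M N = 1 says sum_i t^-1(b_i) e_(s,i) = [s = t]. Applying t frees b_i and puts t on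
   e_(s,i). *)
have := congr1 (fun A : 'M_n => A (rk t^-1%g) (rk s^-1%g)) (mulmxV uM).
rewrite !mxE (inj_eq rk_inj) (inj_eq invg_inj) eq_sym.
move/(congr1 (gal t)); rewrite rmorph_nat => <-.
rewrite rmorph_sum; apply: eq_bigr => i _.
rewrite mxE rmorphM rkK; congr (_ * _).
by rewrite /= gal_invK.
Qed.

End DualBasis.

Section LieSub.
Variables (K : fieldType) (g : lieAlgType K).
Implicit Types x y z : g.

(** Differences occur because [tensor_ind] generates tensors by subtraction. *)
Lemma lieBl x y z : lie (x - y) z = lie x z - lie y z.
Proof. by rewrite lieDl -scaleN1r lieZl scaleN1r. Qed.

Lemma lieBr x y z : lie x (y - z) = lie x y - lie x z.
Proof. by rewrite lieDr -scaleN1r lieZr scaleN1r. Qed.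

End LieSub.

Section Semilinear.
Variables (E : fieldType) (s : {rmorphism E -> E}) (V W : lmodType E).
Variables (f : V -> W).
Hypothesis semi_f : semilinear_map s f.

Lemma semilinearD : {morph f : x y / x + y}.
Proof.
by move=> x y; have := semi_f 1 1 x y; rewrite rmorph1 !scale1r.
Qed.

Lemma semilinear0 : f 0 = 0.
Proof. by apply: (addIr (f 0)); rewrite -semilinearD !add0r. Qed.

Lemma semilinearZ a x : f (a *: x) = s a *: f x.
Proof. by have := semi_f a 0 x 0; rewrite semilinear0 !scaler0 !addr0. Qed.

(** Both sides agree after applying the injective [f], where [s] undoes [t]. With t = s^-1 this
    makes the inverse of each f_s semilinear for s^-1. *)
Lemma semilinear_can (t : E -> E) (f' : W -> V) :
  cancel f f' -> cancel f' f -> cancel t s -> semilinear_map t f'.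
Proof.
move=> fK f'K tK a b x y; apply: (can_inj fK).
by rewrite f'K semilinearD !semilinearZ !tK !f'K.
Qed.

End Semilinear.

Section TensorSums.
Variables (K : fieldType) (U V : lmodType K).

Lemma tens0l (v : V) : tens (0 : U) v = 0.
Proof. by apply: (addIr (tens 0 v)); rewrite -tensDl !add0r. Qed.

Lemma tens0r (u : U) : tens u (0 : V) = 0.
Proof. by apply: (addIr (tens u 0)); rewrite -tensDr !add0r. Qed.

Lemma tens_suml (I : finType) (u : I -> U) (v : V) :
  tens (\sum_i u i) v = \sum_i tens (u i) v.
Proof.
by apply: (big_morph (tens^~ v)) => [u1 u2|]; rewrite (tensDl, tens0l).
Qed.

Lemma tens_sumr (I : finType) (u : U) (v : I -> V) :
  tens u (\sum_i v i) = \sum_i tens u (v i).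
Proof.
by apply: (big_morph (tens u)) => [v1 v2|]; rewrite (tensDr, tens0r).
Qed.

End TensorSums.

Lemma dsum_sumE (K : fieldType) (I J : finType) (V : I -> lieAlgType K)
    (w : J -> lie_dsum V) i :
  (\sum_j w j) i = \sum_j w j i.
Proof.
by apply: (big_morph (fun u : lie_dsum V => u i)) => [u v|]; rewrite ffunE.
Qed.

Section Twist.
Variables (F : fieldType) (E : splittingFieldType F) (g : lieAlgType E).
Local Notation G := [subg 'Gal({:E} / 1)].
Local Notation gal s := (sgval s : gal_of {:E}).
Variables (h : G -> lieAlgType E) (f : forall s, g -> h s).
Arguments f : clear implicits.
Hypothesis f_semi : forall s, semilinear_map (gal s) (f s).
Hypothesis f_lie : forall s, {morph f s : x y / lie x y}.
Local Notation gE := (base_change E (restrict_lie g)).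

Definition twist_tensor (x : restrict_lie g) (a : E) : lie_dsum h :=
  [ffun s => a *: f s x].

(** Scalars of F cross the tensor sign because every s fixes F, so each f_s is F-linear. *)
Lemma twist_tensor_balanced : balanced twist_tensor.
Proof.
split=> [x x' a|x a a'|c x a]; apply/ffunP => s; rewrite !ffunE.
- by rewrite (semilinearD (f_semi s)) scalerDr.
- by rewrite scalerDl.
- by rewrite (semilinearZ (f_semi s)) /= gal_base scalerA mulr_algr.
Qed.

Definition twist (t : gE) : lie_dsum h := tensor_lift twist_tensor t.

Lemma twist_tens x a : twist (tens x a) = twist_tensor x a.
Proof. exact/tensor_lift_tens/twist_tensor_balanced. Qed.

Lemma twistB : {morph twist : t u / t - u}.
Proof. exact/tensor_liftB/twist_tensor_balanced. Qed.

Lemma twistD : {morph twist : t u / t + u}.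
Proof. exact/tensor_liftD/twist_tensor_balanced. Qed.

Lemma twist0 : twist 0 = 0.
Proof. exact/tensor_lift0/twist_tensor_balanced. Qed.

Lemma twist_sum (I : finType) (t : I -> gE) :
  twist (\sum_i t i) = \sum_i twist (t i).
Proof. exact: (big_morph twist twistD twist0). Qed.

(** E acts on the right tensor factor, to which no automorphism is applied; hence E-linearity
    although each f_s is only semilinear. *)
Lemma twist_linear : linear twist.
Proof.
move=> a t u; rewrite twistD; congr (_ + _).
elim/tensor_ind: t => [|t t' IHt IHt'|x b].
- by rewrite [a *: 0]scaler0 twist0 scaler0.
- by rewrite [a *: _]scalerBr !twistB IHt IHt' scalerBr.
rewrite [a *: _]base_scale_tens !twist_tens.
by apply/ffunP => s; rewrite !ffunE scalerA.
Qed.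

Lemma twist_lie : {morph twist : t u / lie t u}.
Proof.
move=> t u; elim/tensor_ind: t => [|t t' IHt IHt'|x a].
- by rewrite [lie 0 u]lie0l twist0 lie0l.
- by rewrite [lie _ u]lieBl !twistB lieBl IHt IHt'.
elim/tensor_ind: u => [|u u' IHu IHu'|y b].
- by rewrite [lie _ 0]lie0r twist0 lie0r.
- by rewrite [lie _ (_ - _)]lieBr !twistB lieBr IHu IHu'.
rewrite [lie _ _]base_lie_tens !twist_tens.
by apply/ffunP => s; rewrite !ffunE f_lie lieZl lieZr scalerA.
Qed.

Lemma twist_bij : galois 1 {:E} -> (forall s, bijective (f s)) ->
  bijective twist.
Proof.
move=> galFE f_bij.
have [n [b [e [spanE dual_b dual_e]]]] := galois_dual_basis galFE.
(* Choice turns the existence of inverses into a family [f']. *)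
have {}f_bij s : {f' | cancel (f s) f' /\ cancel f' (f s)}.
  by apply: cid; case: (f_bij s) => f'; exists f'.
pose f' s := sval (f_bij s).
have fK s : cancel (f s) (f' s) by case: (svalP (f_bij s)).
have f'K s : cancel (f' s) (f s) by case: (svalP (f_bij s)).
have f'_semi s := semilinear_can (f_semi s) (fK s) (f'K s) (gal_invK (gal s)).
pose untwist (w : lie_dsum h) : gE :=
  \sum_s \sum_i tens (e s i *: f' s (w s) : restrict_lie g) (b i).
have untwistB : {morph untwist : u v / u - v}.
  move=> u v; rewrite /untwist -sumrB; apply: eq_bigr => s _.
  rewrite -sumrB; apply: eq_bigr => i _.
  (* Written as u = (u - v) + v, the claim follows from additivity of [tens] and [f']. *)
  apply/eqP; rewrite eq_sym subr_eq -tensDl -[X in _ == tens X _]scalerDr.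
  by rewrite -(semilinearD (f'_semi s)) !ffunE subrK.
exists untwist => [t|w].
  elim/tensor_ind: t => [|t u IHt IHu|x a].
  - by rewrite twist0 -[0 in LHS](subrr 0) untwistB subrr.
  - by rewrite twistB untwistB IHt IHu.
  have [c aE] := spanE a.
  (* The map sending z to sum_s e_(s,i) s^-1(z) is F-linear and, by [dual_b], takes b_j to [i = j];
     so it reads off the i-th coordinate of [a]. *)
  have coefE i : \sum_s e s i * ((gal s)^-1)%g a = (c i)%:A.
    rewrite aE; under eq_bigr => s _ do rewrite linear_sum mulr_sumr.
    rewrite exchange_big (bigD1 i) //= [X in _ + X]big1 => [|j j_neq_i].
      under eq_bigr => s _ do rewrite linearZ /= -scalerAr.
      by rewrite -scaler_sumr dual_b eqxx addr0.
    under eq_bigr => s _ do rewrite linearZ /= -scalerAr.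
    by rewrite -scaler_sumr dual_b eq_sym (negbTE j_neq_i) scaler0.
  rewrite twist_tens /untwist exchange_big /= {2}aE tens_sumr.
  (* The coordinate c_i lies in F, so it moves to the left factor, where it acts on g as an element
     of E and [coefE] can expand it. *)
  apply: eq_bigr => i _; rewrite -tensZ -[c i *: x]/((c i)%:A *: (x : g)).
  rewrite -coefE scaler_suml tens_suml; apply: eq_bigr => s _.
  by rewrite ffunE (semilinearZ (f'_semi s)) fK scalerA.
apply/ffunP => t; rewrite /untwist twist_sum dsum_sumE.
(* Component t applies t to e_(s,i), so [dual_e] kills the terms with s different from t. Each
   f'_s(w_s) lies in g, so f_t applies to it for every s. *)
have termE s :
    twist (\sum_i tens (e s i *: f' s (w s) : restrict_lie g) (b i)) t
      = (s == t)%:R *: f t (f' s (w s)).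
  rewrite twist_sum dsum_sumE -dual_e scaler_suml; apply: eq_bigr => i _.
  by rewrite twist_tens ffunE (semilinearZ (f_semi t)) scalerA.
under eq_bigr => s _ do rewrite termE.
rewrite (bigD1 t) //= eqxx scale1r f'K big1 ?addr0 // => s /negbTE->.
by rewrite scale0r.
Qed.

End Twist.

Theorem theorem4p1 (F : fieldType) (E : splittingFieldType F)
    (galFE : galois 1 {:E}) (g : lieAlgType E)
    (g_conj : [subg 'Gal({:E} / 1)] -> lieAlgType E)
    (g_conjP : forall s : [subg 'Gal({:E} / 1)],
      is_conjugate (sgval s : gal_of {:E}) g (g_conj s)) :
  lie_isomorphic (base_change E (restrict_lie g)) (lie_dsum g_conj).
Proof.
(* Each conjugate comes with the mere existence of an s-isomorphism; one is chosen for every s. *)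
pose f s := sval (cid (g_conjP s)).
have fP s : semilinear_lie_iso (sgval s : gal_of {:E}) (f s).
  exact: (svalP (cid (g_conjP s))).
have f_semi s : semilinear_map (sgval s : gal_of {:E}) (f s) by case: (fP s).
have f_lie s : {morph f s : x y / lie x y} by case: (fP s).
have f_bij s : bijective (f s) by case: (fP s).
pose twistL := GRing.isLinear.Build _ _ _ _ (twist f) (twist_linear f_semi).
exists (HB.pack_for {linear base_change E (restrict_lie g) -> lie_dsum g_conj}
  (twist f) twistL); split.
  exact: twist_bij.
exact: twist_lie.
Qed.
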